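(* Let $\mathcal F=\{f_i\}_{i=1}^m$ be a reverse iterated function system on $X$. For any $a\in X$ and $A\subseteq X$, define $$A_{\mathcal F}(a)=\Bigl(\bigcup_{i=1}^mf_i\bigl(\{a\}\cup(\mathcal O^+_{\mathcal F}(a)\cap A)\bigr)\Bigr)\setminus A.$$ Then $$\mathcal O^+_{\mathcal F}(a)=(\mathcal O^+_{\mathcal F}(a)\cap A)\cup A_{\mathcal F}(a)\cup\bigcup_{b\in A_{\mathcal F}(a)}\mathcal O^+_{\mathcal F}(b).$$ In particular, $\mathcal O^+_{\mathcal F}(a)$ is locally finite if and only if $\mathcal O^+_{\mathcal F}(a)\cap\pi\bigl(\Sigma^\infty_{\mathrm{admis}}(\mathcal F)\bigr)$ is finite.
   Context: $(X,d)$ is an unbounded, locally compact, complete metric space. A reverse iterated function system (RIFS) on $X$ is a finite family $\mathcal F=\{f_i\}_{i=1}^m$ of distinct self-maps of $X$ for which there is $r>1$ (an expansion factor) with $d(f_i(x),f_i(y))\ge r\,d(x,y)$ for all $x,y\in X$ and all $i$; in particular each $f_i$ is injective. For a nonempty finite word $\mathbf i=i_1\cdots i_n$ over $\{1,\dots,m\}$, $f_{\mathbf i}=f_{i_1}\circ\cdots\circ f_{i_n}$; $G^*(\mathcal F)$ is the set of all such maps, and $\mathcal O^+_{\mathcal F}(a)=\{g(a):g\in G^*(\mathcal F)\}$. A subset of $X$ is locally finite if its intersection with every bounded set is finite. Admissible words and coding map: choose $\mathfrak o\in X$ with $\mathcal M=\max_id(\mathfrak o,f_i(\mathfrak o))>0$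 and let $B$ be the open ball with centre $\mathfrak o$ and radius $\frac{\mathcal M}{r-1}+1$. Let $\Sigma^\infty=\{1,\dots,m\}^{\mathbb N}$ and $$\Sigma^\infty_{\mathrm{admis}}(\mathcal F)=\{\mathbf i=i_1i_2\cdots\in\Sigma^\infty:\ f_{i_n}\circ f_{i_{n-1}}\circ\cdots\circ f_{i_1}(X)\cap B\ne\varnothing\text{ for all }n\ge1\}$$ (possibly empty; replacing $B$ by any larger bounded set gives the same set). For $\mathbf i\in\Sigma^\infty_{\mathrm{admis}}(\mathcal F)$ define $\pi(\mathbf i)=\lim_{n\to\infty}f_{i_1}^{-1}\circ\cdots\circ f_{i_n}^{-1}(x_n)$, where $x_n\in f_{i_n}\circ\cdots\circ f_{i_1}(X)\cap B$ are arbitrary; the limit exists and is independent of the choice of $(x_n)$. *)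

(* Defs.v *)
From HB Require Import structures.
From mathcomp Require Import all_boot all_order all_algebra.
From mathcomp Require Import all_classical all_reals.
From mathcomp Require Import topology normedtype sequences.
From mathcomp Require Import lra.

Set Implicit Arguments.
Unset Strict Implicit.
Unset Printing Implicit Defensive.

Import Order.TTheory GRing.Theory Num.Theory.
Import numFieldNormedType.Exports.

Local Open Scope classical_set_scope.
Local Open Scope ring_scope.

#[short(type="completeMetricType")]
HB.structure Definition CompleteMetric (R : numDomainType) :=
  {T of Complete T & Metric R T}.

Section MetricNotions.
Context {R : realType} {X : metricType R}.

(* Finite diameter, which for a nonempty set means being contained in a ball;
   [bounded_set] of MathComp-Analysis is only for normed modules. *)
Definition metric_bounded (A : set X) : Prop :=
  exists D : R, forall x y, A x -> A y -> mdist x y <= D.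

Definition locally_finite (A : set X) : Prop :=
  forall C : set X, metric_bounded C -> finite_set (A `&` C).

End MetricNotions.

Section RIFS.
Context {R : realType} {X : completeMetricType R} {m : nat}.
Implicit Types (f : 'I_m -> X -> X) (r : R) (o a : X) (A : set X)
  (i : nat -> 'I_m).

Definition expansion_factor f r : Prop :=
  1 < r /\ forall j x y, r * mdist x y <= mdist (f j x) (f j y).

(* [injective f] says that the maps f_1, ..., f_m are pairwise distinct. *)
Definition rifs f : Prop :=
  [/\ (0 < m)%N, injective f & exists r, expansion_factor f r].

Definition word_map f (w : seq 'I_m) : X -> X :=
  foldr (fun j g => f j \o g) id w.

Definition word_semigroup f : set (X -> X) :=
  [set word_map f w | w in [set w : seq 'I_m | w != [::]]].

Definition forward_orbit f a : set X := [set g a | g in word_semigroup f].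

Definition exit_set f A a : set X :=
  (\bigcup_j (f j @` ([set a] `|` (forward_orbit f a `&` A)))) `\` A.

Definition displacement f o : R := \big[Num.max/0]_j mdist o (f j o).

Definition coding_ball f r o : set X := ball o (displacement f o / (r - 1) + 1).

(* Infinite words are indexed from 0, so that
   [prefix_map f i n = f (i n.-1) \o ... \o f (i 0)]. *)
Fixpoint prefix_map f i (n : nat) : X -> X :=
  if n is n'.+1 then f (i n') \o prefix_map f i n' else id.

(* [prefix_inv f i n = (f (i 0))^-1 \o ... \o (f (i n.-1))^-1]; the default value
   [point] is only used outside the ranges of the maps. *)
Fixpoint prefix_inv f i (n : nat) : X -> X :=
  if n is n'.+1 then
    prefix_inv f i n' \o 'pinv_(fun=> point) [set: X] (f (i n'))
  else id.

Definition admissible f r o : set (nat -> 'I_m) :=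
  [set i | forall n, (0 < n)%N ->
     range (prefix_map f i n) `&` coding_ball f r o !=set0].

Definition coding_seq f r o i (x : nat -> X) : Prop :=
  forall n, (0 < n)%N -> (range (prefix_map f i n) `&` coding_ball f r o) (x n).

(* The common limit for all choices of the points x_n;
   [coding_mapP] shows that it exists for admissible words. *)
Definition coding_map f r o i : X :=
  get [set p | forall x, coding_seq f r o i x ->
     prefix_inv f i n (x n) @[n --> \oo] --> p].

Lemma prefix_map_expand f r i n x y : expansion_factor f r ->
  r ^+ n * mdist x y <= mdist (prefix_map f i n x) (prefix_map f i n y).
Proof.
move=> [r1 fr]; elim: n => [|n IH]; first by rewrite expr0 mul1r.
rewrite exprS -mulrA; apply: le_trans (fr _ _ _).
by rewrite ler_pM2l// (lt_trans _ r1).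
Qed.

Lemma expansion_inj f r j : expansion_factor f r -> injective (f j).
Proof.
move=> [r1 fr] x y fxy; apply: (@mdist_positivity R X).
apply/eqP; rewrite eq_le mdist_ge0 andbT.
have := fr j x y; rewrite fxy mdistxx pmulr_rle0// (lt_trans _ r1)//.
Qed.

Lemma prefix_invK f r i n : expansion_factor f r ->
  cancel (prefix_map f i n) (prefix_inv f i n).
Proof.
move=> fr; elim: n => [//|n IH] x /=.
rewrite pinvKV ?IH ?inE// => y z _ _; exact: expansion_inj fr _ _.
Qed.

Lemma displacement_ge f o j : mdist o (f j o) <= displacement f o.
Proof. exact: (le_bigmax _ (fun j => mdist o (f j o))). Qed.

Lemma coding_ball_pull f r o j z : expansion_factor f r ->
  coding_ball f r o (f j z) -> coding_ball f r o z.
Proof.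
move=> [r1 fr]; rewrite /coding_ball !ballEmdist/=.
have /= := displacement_ge f o j; set M := displacement f o => oM h.
have r10 : r - 1 != 0 by rewrite subr_eq0 gt_eqF.
have rho : (M / (r - 1) + 1) * (r - 1) = M + (r - 1).
  by rewrite mulrDl mul1r divfK.
move: h rho; set p := _ + 1 => h rho.
have h1 := fr j o z.
have h2 := metric_triangle (f j o) o (f j z).
rewrite (metric_sym (f j o) o) in h2.
rewrite -(@ltr_pM2l _ r) ?(lt_trans _ r1)//.
rewrite mulrBr mulr1 (mulrC p) in rho; lra.
Qed.

Lemma coding_ball_prefix f r o i k n z : expansion_factor f r ->
  coding_ball f r o (prefix_map f i (k + n) z) ->
  coding_ball f r o (prefix_map f i n z).
Proof.
move=> fr; elim: k => [//|k IH] h; exact/IH/(coding_ball_pull fr h).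
Qed.

Lemma coding_seq_close f r o i x x' n k : expansion_factor f r ->
  coding_seq f r o i x -> coding_seq f r o i x' -> (0 < n)%N -> (n <= k)%N ->
  mdist (prefix_inv f i n (x n)) (prefix_inv f i k (x' k)) <=
  (displacement f o / (r - 1) + 1) *+ 2 / r ^+ n.
Proof.
move=> fr hx hx' n0 nk.
have [[y _ yE] xB] := hx _ n0.
have [[y' _ yE'] xB'] := hx' _ (leq_trans n0 nk).
rewrite -yE -yE' !(prefix_invK _ _ fr).
have := fr => -[r1 _].
rewrite ler_pdivlMr ?exprn_gt0 ?(lt_trans _ r1)// mulrC.
apply: le_trans (prefix_map_expand i n y y' fr) _.
move: xB'; rewrite -yE' -(subnK nk) => /(coding_ball_prefix fr).
move: xB; rewrite -yE /coding_ball !ballEmdist/= => h1 h2.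
apply: le_trans (metric_triangle _ o _) _.
by rewrite (metric_sym _ o) mulr2n lerD ?ltW.
Qed.

Lemma coding_close_cvg0 (c r : R) : 1 < r -> c / r ^+ n @[n --> \oo] --> (0 : R).
Proof.
move=> r1; rewrite (_ : (fun n => _) = geometric c r^-1); last first.
  by apply/funext => n /=; rewrite exprVn.
apply: cvg_geometric; rewrite ger0_norm ?invr_ge0 ?(le_trans _ (ltW r1))//.
by rewrite invf_lt1// (lt_trans _ r1).
Qed.

Lemma coding_seq_cvg f r o i : expansion_factor f r -> admissible f r o i ->
  exists p : X, forall x, coding_seq f r o i x ->
    prefix_inv f i n (x n) @[n --> \oo] --> p.
Proof.
move=> fr adm; have := fr => -[r1 _].
have /choice[x0 hx0] : forall n, exists z, (0 < n)%N ->
    (range (prefix_map f i n) `&` coding_ball f r o) z.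
  move=> n; have [n0|] := ltnP 0 n; last by exists point.
  by have [z zP] := adm n n0; exists z.
pose C := (displacement f o / (r - 1) + 1) *+ 2.
have small (e : R) : 0 < e -> exists2 N, (0 < N)%N &
      forall n, (N <= n)%N -> C / r ^+ n < e.
  move=> e0; have /cvgrPdist_lt/(_ e e0)[N _ NP] := coding_close_cvg0 C r1.
  exists N.+1 => // n Nn; have := NP n (ltnW Nn).
  by rewrite sub0r normrN; apply: le_lt_trans; exact: ler_norm.
pose y0 n := prefix_inv f i n (x0 n).
have /cauchy_cvg yc : cauchy (y0 @ \oo).
  apply/cauchy_exP => e e0; have [N N0 Ne] := small e e0.
  exists (y0 N); exists N => // k /= Nk; rewrite ballEmdist/=.
  exact: le_lt_trans (coding_seq_close fr hx0 hx0 N0 Nk) (Ne N (leqnn N)).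
exists (lim (y0 @ \oo)) => x hx; apply/cvg_ballP => e e0.
have e2 : 0 < e / 2 by rewrite divr_gt0.
have /cvg_ballP/(_ _ e2) yl := yc.
have [N N0 Ne] := small _ e2.
near=> n.
rewrite [e]splitr; apply: (@ball_triangle _ _ (y0 n)).
  by near: n; exact: yl.
rewrite ballEmdist/=.
have Nn : (N <= n)%N by near: n; exact: nbhs_infty_ge.
apply: le_lt_trans (Ne n Nn).
exact: coding_seq_close fr hx0 hx (leq_trans N0 Nn) (leqnn n).
Unshelve. all: by end_near. Qed.

Lemma coding_mapP f r o i x : expansion_factor f r -> admissible f r o i ->
  coding_seq f r o i x ->
  prefix_inv f i n (x n) @[n --> \oo] --> coding_map f r o i.
Proof.
move=> fr adm hx; have ex := coding_seq_cvg fr adm.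
exact: (@getPex X [set p | forall x, _ -> _] ex x hx).
Qed.

End RIFS.

(* Main.v *)
Require Import Defs.
From mathcomp Require Import all_boot all_order all_algebra.
From mathcomp Require Import all_classical all_reals.
From mathcomp Require Import topology normedtype.
From mathcomp Require Import lra.

Set Implicit Arguments.
Unset Strict Implicit.
Unset Printing Implicit Defensive.

Import Order.TTheory GRing.Theory Num.Theory.
Import numFieldNormedType.Exports.

Local Open Scope classical_set_scope.
Local Open Scope ring_scope.

(** The decomposition of the orbit of [a] follows a word map letter by letter:
    as long as the successive images of [a] stay in [A] nothing is to be said,
    and the first image outside [A] is a point of the exit set, in whose forward
    orbit all later images lie.

    For local finiteness, let [P] be the set of coding points.  It is bounded,
    because the inverse branches send the coding ball into itself, so a locally
    finite orbit meets [P] in a finite set.  Conversely, the key fact is that a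
    point [b] whose forward orbit is not locally finite belongs to [P]
    ([forward_orbit_coding]).  Indeed, if the orbit of [b] has infinitely many
    points in a large ball around [o], then by pigeonhole so has the orbit of some [f j b], and
    iterating (Koenig's lemma) gives an infinite word along which the images of
    [b] never leave that ball.  As the maps expand, an orbit that stays bounded has to
    lie within [displacement f o / (r - 1)] of [o], hence in the coding ball;
    so the word is admissible, and its coding point is the limit of the constant
    sequence [b].  Now the decomposition with [A := P] writes the orbit of [a] as
    a finite set together with finitely many forward orbits of points outside
    [P], all of them locally finite. *)

(** * Words and forward orbits *)

Section Orbits.
Context {R : realType} {X : completeMetricType R} {m : nat}.
Implicit Types (f : 'I_m -> X -> X) (a b x y : X) (A : set X).

Lemma word_map_cat f (v w : seq 'I_m) x :
  word_map f (v ++ w) x = word_map f v (word_map f w x).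
Proof. by elim: v => //= j v ->. Qed.

Lemma forward_orbitP f a y :
  forward_orbit f a y <-> exists2 w, w != [::] & y = word_map f w a.
Proof.
split=> [[_ [w /= w0 <-] <-]|[w w0 ->]]; first by exists w.
by exists (word_map f w) => //; exists w.
Qed.

Lemma forward_orbit1 f a j : forward_orbit f a (f j a).
Proof. by apply/forward_orbitP; exists [:: j]. Qed.

Lemma forward_orbit_trans f a b y :
  forward_orbit f a b -> forward_orbit f b y -> forward_orbit f a y.
Proof.
move=> /forward_orbitP[w w0 ->] /forward_orbitP[v v0 ->].
apply/forward_orbitP; exists (v ++ w); last by rewrite word_map_cat.
by case: v v0.
Qed.

(** A forward orbit splits according to the first map that is applied. *)
Lemma forward_orbit_first f a :
  forward_orbit f a = \bigcup_j ([set f j a] `|` forward_orbit f (f j a)).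
Proof.
apply/seteqP; split=> y.
  move=> /forward_orbitP[w]; case/lastP: w => // w j _ ->.
  exists j => //; rewrite -cats1 word_map_cat /=.
  case: w => [|k w]; first by left.
  by right; apply/forward_orbitP; exists (k :: w).
move=> [j _ [->|]]; first exact: forward_orbit1.
exact/forward_orbit_trans/forward_orbit1.
Qed.

Lemma exit_set_sub_orbit f A a : exit_set f A a `<=` forward_orbit f a.
Proof.
move=> y [[j _ [x [->|[ax _]] <-]] _]; first exact: forward_orbit1.
exact/(forward_orbit_trans ax)/forward_orbit1.
Qed.

Lemma forward_orbit_decomp f A a :
  forward_orbit f a = (forward_orbit f a `&` A) `|` exit_set f A a
    `|` \bigcup_(b in exit_set f A a) forward_orbit f b.
Proof.
apply/seteqP; split=> [y|y [[[]//|/exit_set_sub_orbit //]|[b]]]; last first.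
  by move=> /exit_set_sub_orbit; exact: forward_orbit_trans.
(* One map applied to [a] or to an orbit point in [A] either stays in [A] or
   exits. *)
have enter j x : x = a \/ (forward_orbit f a `&` A) x ->
    (forward_orbit f a `&` A) (f j x) \/ exit_set f A a (f j x).
  move=> ax; have [Afx|nAfx] := pselect (A (f j x)).
    left; split=> //; case: ax => [->|[ax _]]; first exact: forward_orbit1.
    exact/(forward_orbit_trans ax)/forward_orbit1.
  by right; split=> //; exists j => //; exists x.
move=> /forward_orbitP[w w0 ->] {y}.
elim: w w0 => // j w IH _ /=.
case: w IH => [_|k w /(_ isT)]; first by left; apply: enter; left.
set x := word_map _ _ _ => -[[ax|ex]|[b eb bx]].
- by left; apply: enter; right.
- by right; exists x => //; exact: forward_orbit1.
- by right; exists b => //; exact/(forward_orbit_trans bx)/forward_orbit1.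
Qed.

(** This holds as the exit set is covered by the images of a finite set under
    finitely many maps. *)
Lemma exit_set_finite f A a :
  finite_set (forward_orbit f a `&` A) -> finite_set (exit_set f A a).
Proof.
move=> fin; apply: finite_setD; apply: bigcup_finite => // j _.
by apply: finite_image; rewrite finite_setU.
Qed.

End Orbits.

(** * Expansion and bounded orbits *)

Section Expansion.
Context {R : realType} {X : completeMetricType R} {m : nat}.
Variables (f : 'I_m -> X -> X) (r : R) (o : X).
Hypothesis fr : expansion_factor f r.

Lemma expansion_dist_center j x :
  r * mdist o x - displacement f o <= mdist o (f j x).
Proof.
have h1 := fr.2 j o x.
have h2 := metric_triangle (f j o) o (f j x).
have h3 := displacement_ge f o j.
rewrite (metric_sym (f j o) o) in h2; rewrite /= in h1 h2 h3; lra.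
Qed.

(** Every ball centred at [o] that is large enough is stable under the inverse
    branches, so an orbit that reaches such a ball started inside. *)
Lemma forward_orbit_pull (rho : R) x y : displacement f o <= rho * (r - 1) ->
  forward_orbit f x y -> mdist o y <= rho -> mdist o x <= rho.
Proof.
move=> hrho /forward_orbitP[w _ ->] {y}.
have r0 : 0 < r by rewrite (lt_trans _ fr.1).
elim: w => //= j w IH h; apply: IH.
have := expansion_dist_center j (word_map f w x).
rewrite -(@ler_pM2l _ r)// => h1; rewrite mulrBr mulr1 in hrho.
rewrite (mulrC r rho); lra.
Qed.

(** The excess over the distance [displacement f o / (r - 1)] is multiplied by at
    least [r] at each step, so it cannot be positive along a bounded orbit. *)
Lemma bounded_orbit_dist (i : nat -> 'I_m) b (rho : R) :
  (forall n, mdist o (prefix_map f i n b) <= rho) ->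
  forall n, mdist o (prefix_map f i n b) <= displacement f o / (r - 1).
Proof.
move=> bnd n; have r1 := fr.1; have r0 : 0 < r by rewrite (lt_trans _ r1).
set K := _ / _.
have KE : displacement f o = r * K - K.
  by rewrite -[X in _ - X]mul1r -mulrBl mulrC divfK// subr_eq0 gt_eqF.
have grow k : r ^+ k * (mdist o (prefix_map f i n b) - K) <=
    mdist o (prefix_map f i (k + n) b) - K.
  elim: k => [|k IH]; first by rewrite expr0 mul1r.
  have /= := expansion_dist_center (i (k + n)%N) (prefix_map f i (k + n) b).
  move: IH; rewrite -(@ler_pM2l _ r)// mulrA -exprS KE mulrBr => IH h; lra.
rewrite -subr_le0; have /(cvg_lim (@Rhausdorff R)) <- :=
  coding_close_cvg0 (rho - K) r1.
apply: limr_ge; first by apply/cvg_ex; exists 0; exact: coding_close_cvg0.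
near=> k; rewrite ler_pdivlMr ?exprn_gt0// mulrC.
by apply: le_trans (grow k) _; rewrite lerD2r.
Unshelve. all: by end_near. Qed.

Lemma closed_ball_metric_bounded (rho : R) :
  metric_bounded [set x : X | mdist o x <= rho].
Proof.
exists (rho + rho) => x y /= ox oy.
apply: le_trans (metric_triangle _ o _) _.
by rewrite (metric_sym _ o) lerD.
Qed.

(** The radius can be taken above any prescribed bound [k]. *)
Lemma metric_bounded_sub_ball (C : set X) (k : R) : metric_bounded C ->
  exists2 rho, k <= rho & C `<=` [set x : X | mdist o x <= rho].
Proof.
move=> [D CD]; have [[c Cc]|C0] := pselect (C !=set0); last first.
  by exists k => // x Cx; case: C0; exists x.
exists (Num.max k (mdist o c + D)) => [|x Cx /=].
  by rewrite le_max lexx.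
apply: le_trans (metric_triangle _ c _) _.
by rewrite le_max lerD2l CD ?orbT.
Qed.

(** * Coding points *)

(** A coding point is a limit of points of the coding ball, which the inverse
    branches send into itself. *)
Lemma coding_map_bounded : metric_bounded (coding_map f r o @` admissible f r o).
Proof.
set K := displacement f o / (r - 1) + 1.
have in_ball i : admissible f r o i -> mdist o (coding_map f r o i) <= K + 1.
  move=> adm.
  have /choice[x xP] : forall n, exists z, (0 < n)%N ->
      (range (prefix_map f i n) `&` coding_ball f r o) z.
    by move=> n; have [/adm[z]|] := ltnP 0 n; [exists z|exists point].
  have /cvg_ballP/(_ 1 ltr01)[N _ NP] := coding_mapP fr adm xP.
  have [[y _ yE] xB] := xP N.+1 isT.
  have := NP N.+1 (leqnSn N); rewrite -yE (prefix_invK _ _ fr).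
  rewrite ballEmdist /= => /ltW close.
  move: xB; rewrite -yE -[X in prefix_map f i X]addn0.
  move=> /(coding_ball_prefix fr); rewrite /coding_ball ballEmdist /= -/K.
  move=> /ltW oy; apply: le_trans (metric_triangle _ y _) _.
  by rewrite lerD// metric_sym.
have [D hD] := closed_ball_metric_bounded (K + 1).
by exists D => _ _ [i adm <-] [i' adm' <-]; apply: hD; exact: in_ball.
Qed.

(** A point all of whose images along a word stay bounded is the coding point of
    that word. *)
Lemma coding_map_bounded_orbit (i : nat -> 'I_m) b (rho : R) :
  (forall n, mdist o (prefix_map f i n b) <= rho) ->
  admissible f r o i /\ coding_map f r o i = b.
Proof.
move=> bnd.
have cs : coding_seq f r o i (fun n => prefix_map f i n b).
  move=> n _; split; first by exists b.
  rewrite /coding_ball ballEmdist /=.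
  by apply: le_lt_trans (bounded_orbit_dist bnd n) _; rewrite ltrDl.
have adm : admissible f r o i by move=> n n0; eexists; exact: cs n n0.
split=> //; have := coding_mapP fr adm cs.
under eq_fun do rewrite (prefix_invK _ _ fr).
move=> h; apply: (cvg_unique (@metric_hausdorff R X) h); exact: cvg_cst.
Qed.

(** Koenig's lemma produces a word whose coding point is [b]. *)
Lemma forward_orbit_coding b : ~ locally_finite (forward_orbit f b) ->
  (coding_map f r o @` admissible f r o) b.
Proof.
have r10 : 0 < r - 1 by rewrite subr_gt0 fr.1.
move=> /existsNP[C /not_implyP[Cb nfin]].
have [rho hrho sub] := metric_bounded_sub_ball (displacement f o / (r - 1)) Cb.
rewrite ler_pdivrMr// in hrho.
(* [T x]: infinitely many images of [x] lie in [C]. *)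
pose T x := ~ finite_set (forward_orbit f x `&` C).
have step x : T x -> exists j, T (f j x).
  move=> Tx; apply/not_existsP => fin; apply: Tx.
  rewrite forward_orbit_first setI_bigcupl; apply: bigcup_finite => // j _.
  rewrite setIUl finite_setU; split; first exact/finite_setIl/finite_set1.
  exact: contrapT (fin j).
(* [j0] is a default letter for the points where [T] fails. *)
have [j0 _] := step b nfin.
have /choice[h hT] : forall x, exists j, T x -> T (f j x).
  by move=> x; have [/step[j]|] := pselect (T x); [exists j|exists j0].
pose x n := iter n (fun z => f (h z) z) b; pose i n := h (x n).
(* The choice of the letters [h] makes [x] the sequence of images of [b] along
   the word [i], and [T] holds at each of them. *)
have xE n : prefix_map f i n b = x n by elim: n => //= n ->.
have Tx n : T (x n) by elim: n => //= n; exact: hT.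
have [|adm <-] := @coding_map_bounded_orbit i b rho; last by exists i.
move=> n; rewrite xE.
have /set0P[y [xy /sub]] : forward_orbit f (x n) `&` C != set0.
  by apply/eqP => E; apply: (Tx n); rewrite E.
exact: forward_orbit_pull.
Qed.

End Expansion.

Theorem proposition2p8 (R : realType) (X : completeMetricType R)
    (unbX : ~ metric_bounded [set: X]) (lcX : locally_compact [set: X])
    (m : nat) (f : 'I_m -> X -> X) (fP : rifs f) (a : X) :
  (forall A : set X,
     forward_orbit f a =
       (forward_orbit f a `&` A) `|` exit_set f A a
         `|` \bigcup_(b in exit_set f A a) forward_orbit f b) /\
  (forall (r : R) (o : X), expansion_factor f r -> 0 < displacement f o ->
     locally_finite (forward_orbit f a) <->
     finite_set (forward_orbit f a `&` (coding_map f r o @` admissible f r o))).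
Proof.
split=> [A|r o fr _]; first exact: forward_orbit_decomp.
split=> [lf|fin]; first exact/lf/coding_map_bounded.
have exfin := exit_set_finite fin.
move=> C Cb.
rewrite (forward_orbit_decomp f (coding_map f r o @` admissible f r o) a).
rewrite setIUl finite_setU; split.
  by apply: finite_setIl; rewrite finite_setU.
rewrite setI_bigcupl; apply: bigcup_finite => // b [_ nPb].
apply: contrapT => nlf; apply: nPb; apply: forward_orbit_coding => // lfb.
exact/nlf/lfb.
Qed.
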